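(* If $X_{\rm trn}X_{\rm trn}^\dagger$ is a diagonal matrix, then for any $u\in\mathcal{U}=[-\bar u,\bar u]^N$ and any $W$, there exist $L_w^\gamma,\mu_w^\gamma=\mathcal{O}(\gamma)$ such that $\ell_\gamma(u,W)$ is $L_w^\gamma$-smooth and $\mu_w^\gamma$-PL over $W$. Moreover, $\ell_\gamma(u,W)$ is $\gamma\ell_{\rm trn}(W)$-smooth and $\frac{\gamma c(W)\psi(\bar u)(1-\psi(\bar u))^2}{4}$-PL over $u\in\mathcal{U}$, where $$c(W)=\min_i\left\{\|y_i^\top-x_i^\top W\|^2-\|y_i\|^2\,\mathds{1}\big([X_{\rm trn}X_{\rm trn}^\dagger]_{ii}\ne1\big)\right\}_{>0}.$$
   Context: $X_{\rm trn}\in\mathbb{R}^{N\times m}$ has rows $x_i^\top$, $Y_{\rm trn}\in\mathbb{R}^{N\times n}$ has rows $y_i^\top$, $X_{\rm val}\in\mathbb{R}^{N'\times m}$, $Y_{\rm val}\in\mathbb{R}^{N'\times n}$, $W\in\mathbb{R}^{m\times n}$, $u\in\mathbb{R}^N$, $\gamma>0$, $\bar u>0$, $m\ge\max\{N,N'\}$. $\psi(t)=1/(1+e^{-t})$ is the sigmoid, $\psi_N(u)=\operatorname{diag}(\psi(u_1),\dots,\psi(u_N))$, $\sqrt\cdot$ is entrywise, $\dagger$ is the Moore–Penrose pseudoinverse, $\|\cdot\|$ is the Frobenius/Euclidean norm, $\mathds{1}(\cdot)$ is the indicator function. Standing assumption of the paper: $[X_{\rm val};X_{\rm trn}]$ is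 rank-deficient, but there exists $u^*\in\mathcal{U}$ with $\operatorname{rank}([X_{\rm val};\sqrt{\psi_N(u^* )}X_{\rm trn}])=N+N'-|\{i:\psi(u_i^* )<\tilde\psi\}|$ for a threshold $\tilde\psi>0$ close to $0$. $\ell_{\rm val}(W)=\frac12\|Y_{\rm val}-X_{\rm val}W\|^2$, $\ell_{\rm trn}(u,W)=\frac12\|\sqrt{\psi_N(u)}(Y_{\rm trn}-X_{\rm trn}W)\|^2$, $\ell_{\rm trn}(W)=\frac12\|Y_{\rm trn}-X_{\rm trn}W\|^2$, $\ell_{\rm trn}^*(u)=\min_W\ell_{\rm trn}(u,W)$, $\ell_\gamma(u,W)=\ell_{\rm val}(W)+\gamma(\ell_{\rm trn}(u,W)-\ell_{\rm trn}^*(u))$. Notation $\{\theta\}_{>0}$: equals $\theta$ if $\theta>0$ and $+\infty$ otherwise; it is applied to each term before taking $\min_i$. If no term is positive, $c(W)$ may be set to any positive number. A function is $L$-smooth if its gradient is $L$-Lipschitz; a differentiable $h$ is $\mu$-PL on a set if $\|\nabla h(\theta)\|^2\ge2\mu(h(\theta)-\inf h)$ for all $\theta$ in the set, where $\inf h$ is the infimum of $h$ over its whole domain. The constants $L_w^\gamma,\mu_w^\gamma$ are positive, do not depend on $u\in\mathcal{U}$ or $W$, and $\mathcal{O}(\gamma)$ refers to the dependence on $\gamma$. *)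

(* Defs.v *)
From HB Require Import structures.
From mathcomp Require Import all_boot all_order all_algebra.
From mathcomp Require Import all_classical all_reals all_analysis.

Set Implicit Arguments.
Unset Strict Implicit.
Unset Printing Implicit Defensive.

Import Order.TTheory GRing.Theory Num.Theory.
Import numFieldNormedType.Exports.

Local Open Scope classical_set_scope.
Local Open Scope ring_scope.

(* The library norm `|A| on matrices is the sup norm; it induces the same
   topology (hence the same derivatives) but not the same constants. *)
Definition frob (R : realType) (p q : nat) (A : 'M[R]_(p, q)) : R :=
  Num.sqrt (\sum_i \sum_j A i j ^+ 2).

Definition sigmoid (R : realType) (t : R) : R := (1 + expR (- t))^-1.

Definition is_moore_penrose (R : realType) (p q : nat)
    (A : 'M[R]_(p, q)) (B : 'M[R]_(q, p)) : Prop :=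
  [/\ A *m B *m A = A,
      B *m A *m B = B,
      (A *m B)^T = A *m B &
      (B *m A)^T = B *m A].

Definition mp_inv (R : realType) (p q : nat) (A : 'M[R]_(p, q)) : 'M[R]_(q, p) :=
  xget 0 [set B | is_moore_penrose A B].

Lemma frob_sq (R : realType) (p q : nat) (A : 'M[R]_(p, q)) :
  frob A ^+ 2 = \tr (A^T *m A).
Proof.
rewrite sqr_sqrtr; last by do 2 (apply: sumr_ge0 => ? _); exact: sqr_ge0.
rewrite /mxtrace exchange_big /=; apply: eq_bigr => j _.
by rewrite !mxE; apply: eq_bigr => i _; rewrite !mxE expr2.
Qed.

Lemma frob_sq_eq0 (R : realType) (p q : nat) (A : 'M[R]_(p, q)) :
  frob A ^+ 2 = 0 -> A = 0.
Proof.
have ge0 i : 0 <= \sum_j A i j ^+ 2 by apply: sumr_ge0 => ? _; exact: sqr_ge0.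
rewrite sqr_sqrtr ?sumr_ge0// => /psumr_eq0P A0.
apply/matrixP => i j; rewrite [RHS]mxE; apply/eqP; rewrite -sqrf_eq0; apply/eqP.
by apply: (psumr_eq0P _ (A0 _ i isT)) => // ? _; exact: sqr_ge0.
Qed.

Lemma frob_sq_orth_le (R : realType) (p q : nat) (Q Z : 'M[R]_(p, q)) :
  Z^T *m Q = 0 -> frob Q ^+ 2 <= frob (Q + Z) ^+ 2.
Proof.
move=> ZQ; have QZ : Q^T *m Z = 0.
  by apply: trmx_inj; rewrite trmx_mul trmxK ZQ trmx0.
have DT : (Q + Z)^T = Q^T + Z^T by rewrite linearD.
rewrite [leRHS]frob_sq DT mulmxDl !mulmxDr ZQ QZ add0r addr0.
by rewrite linearD /= -!frob_sq lerDl sqr_ge0.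
Qed.

Lemma gram_unitmx (R : realType) (p q : nat) (A : 'M[R]_(p, q)) :
  row_free A -> A *m A^T \in unitmx.
Proof.
move=> Afree; rewrite -row_free_unit -kermx_eq0; apply/rowV0P => v /sub_kermxP.
rewrite mulmxA => vAA.
have vA0 : v *m A = 0.
  apply: trmx_inj; rewrite trmx0; apply: frob_sq_eq0.
  by rewrite frob_sq trmxK trmx_mul mulmxA vAA mul0mx mxtrace0.
by apply: (row_free_inj Afree); rewrite vA0 mul0mx.
Qed.

Lemma is_moore_penrose_uniq (R : realType) (p q : nat) (A : 'M[R]_(p, q))
    (B C : 'M[R]_(q, p)) :
  is_moore_penrose A B -> is_moore_penrose A C -> B = C.
Proof.
move=> [ABA BAB AB BA] [ACA CAC AC CA].
have E1 : A *m B = A *m C.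
  by rewrite -AB -{1}ACA -mulmxA trmx_mul AB AC mulmxA ABA.
have E2 : B *m A = C *m A.
  by rewrite -BA -{1}ACA mulmxA mulmxA -(mulmxA (B *m A)) trmx_mul BA CA mulmxA
    -(mulmxA C A B) -(mulmxA C) ABA.
by rewrite -BAB E2 -mulmxA E1 mulmxA CAC.
Qed.

Lemma mp_invP (R : realType) (p q : nat) (A : 'M[R]_(p, q)) :
  is_moore_penrose A (mp_inv A).
Proof.
rewrite /mp_inv; apply: (@xgetPex _ 0 [set B | is_moore_penrose A B]).
have [r [C [D [Cfull Dfree E]]]] :
    exists r (C : 'M[R]_(p, r)) (D : 'M[R]_(r, q)),
    [/\ row_free C^T, row_free D & A = C *m D].
  exists (\rank A), (col_base A), (row_base A); split.
  - by rewrite /row_free mxrank_tr; exact: col_base_full.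
  - exact: row_base_free.
  - by rewrite mulmx_base.
have DD : D *m D^T \in unitmx := gram_unitmx Dfree.
have CC : C^T *m C \in unitmx by have := gram_unitmx Cfull; rewrite trmxK.
pose U := invmx (D *m D^T); pose V := invmx (C^T *m C).
have UT : U^T = U by rewrite /U trmx_inv trmx_mul trmxK.
have VT : V^T = V by rewrite /V trmx_inv trmx_mul trmxK.
exists (D^T *m U *m V *m C^T).
have AB : A *m (D^T *m U *m V *m C^T) = C *m V *m C^T.
  by rewrite E !mulmxA -(mulmxA C D) -(mulmxA C) mulmxV // mulmx1.
have BA : (D^T *m U *m V *m C^T) *m A = D^T *m U *m D.
  by rewrite E !mulmxA -(mulmxA _ C^T C) -(mulmxA _ V) mulVmx // mulmx1.
split.
- by rewrite AB E !mulmxA -(mulmxA _ C^T C) -(mulmxA C V) mulVmx // mulmx1.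
- by rewrite BA !mulmxA -(mulmxA _ D D^T) -(mulmxA _ U (D *m _)) mulVmx // mulmx1.
- by rewrite AB !trmx_mul trmxK VT mulmxA.
- by rewrite BA !trmx_mul trmxK UT mulmxA.
Qed.

Definition box (R : realType) (N : nat) (ubar : R) : set 'rV[R]_N :=
  [set u | forall i, - ubar <= u 0 i <= ubar].

Definition psi_mx (R : realType) (N : nat) (u : 'rV[R]_N) : 'M[R]_N :=
  diag_mx (map_mx (@sigmoid R) u).

Definition sqrt_psi_mx (R : realType) (N : nat) (u : 'rV[R]_N) : 'M[R]_N :=
  map_mx Num.sqrt (psi_mx u).

(* 1/2 ||Y - X W||^2: the validation loss on (Xval, Yval), and the unweighted
   training loss on (Xtrn, Ytrn). *)
Definition lsq (R : realType) (p m n : nat) (X : 'M[R]_(p, m))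
    (Y : 'M[R]_(p, n)) (W : 'M[R]_(m, n)) : R :=
  2^-1 * frob (Y - X *m W) ^+ 2.

Definition lw (R : realType) (N m n : nat) (X : 'M[R]_(N, m))
    (Y : 'M[R]_(N, n)) (u : 'rV[R]_N) (W : 'M[R]_(m, n)) : R :=
  2^-1 * frob (sqrt_psi_mx u *m (Y - X *m W)) ^+ 2.

(* The infimum is attained, see lw_star_min. *)
Definition lw_star (R : realType) (N m n : nat) (X : 'M[R]_(N, m))
    (Y : 'M[R]_(N, n)) (u : 'rV[R]_N) : R :=
  inf (range (lw X Y u)).

Lemma lw_star_min (R : realType) (N m n : nat) (X : 'M[R]_(N, m))
    (Y : 'M[R]_(N, n)) (u : 'rV[R]_N) :
  exists2 W0, lw_star X Y u = lw X Y u W0 & forall W, lw X Y u W0 <= lw X Y u W.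
Proof.
pose A := sqrt_psi_mx u *m X; pose B := sqrt_psi_mx u *m Y.
have lwE W : lw X Y u W = 2^-1 * frob (B - A *m W) ^+ 2.
  by rewrite /lw mulmxBr mulmxA.
have [ABA _ AB _] := mp_invP A.
pose W0 := mp_inv A *m B.
have W0min W : lw X Y u W0 <= lw X Y u W.
  rewrite !lwE ler_pM2l ?invr_gt0 ?ltr0n//.
  pose Q := B - A *m W0; pose Z := A *m (W0 - W).
  have -> : B - A *m W = Q + Z by rewrite /Q /Z mulmxBr addrA subrK.
  have AQ : A^T *m Q = 0.
    have AAA : A^T *m (A *m mp_inv A) = A^T by rewrite -AB -trmx_mul ABA.
    by rewrite /Q mulmxBr /W0 (mulmxA A (mp_inv A)) (mulmxA A^T (A *m mp_inv A)) AAA subrr.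
  have ZQ : Z^T *m Q = 0 by rewrite trmx_mul -mulmxA AQ mulmx0.
  exact: frob_sq_orth_le.
exists W0 => //; apply/eqP; rewrite eq_le; apply/andP; split.
  by apply: ge_inf; [exists (lw X Y u W0) => _ [W _ <-] | exists W0].
apply: lb_le_inf; first by exists (lw X Y u W0); exists W0.
by move=> _ [W _ <-].
Qed.

Definition lgamma (R : realType) (N N' m n : nat)
    (Xtrn : 'M[R]_(N, m)) (Ytrn : 'M[R]_(N, n))
    (Xval : 'M[R]_(N', m)) (Yval : 'M[R]_(N', n))
    (gamma : R) (u : 'rV[R]_N) (W : 'M[R]_(m, n)) : R :=
  lsq Xval Yval W + gamma * (lw Xtrn Ytrn u W - lw_star Xtrn Ytrn u).

Definition grad (R : realType) (p q : nat) (f : 'M[R]_(p, q) -> R)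
    (x : 'M[R]_(p, q)) : 'M[R]_(p, q) :=
  \matrix_(i, j) 'D_(delta_mx i j) f x.

Definition smooth (R : realType) (p q : nat) (f : 'M[R]_(p, q) -> R)
    (L : R) : Prop :=
  (forall x, differentiable f x) /\
  (forall x y, frob (grad f x - grad f y) <= L * frob (x - y)).

(* The infimum is over the whole domain, not over A. The real-valued inf is a
   junk value on sets unbounded below, which has_lbound rules out. *)
Definition PL_on (R : realType) (p q : nat) (A : set 'M[R]_(p, q))
    (f : 'M[R]_(p, q) -> R) (mu : R) : Prop :=
  [/\ forall x, differentiable f x,
      has_lbound (range f) &
      forall x, A x ->
        2 * mu * (f x - inf (range f)) <= frob (grad f x) ^+ 2].

Canonical pinfty_filter_on (R : realType) :=
  FilterType (pinfty_nbhs R) (@proper_pinfty_nbhs R).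

Definition bigO_infty (R : realType) (f g : R -> R) : Prop := f =O_+oo g.

Definition pos_or_infty (R : realType) (t : R) : \bar R :=
  if 0 < t then t%:E else +oo%E.

Definition cmin (R : realType) (N m n : nat) (X : 'M[R]_(N, m))
    (Y : 'M[R]_(N, n)) (W : 'M[R]_(m, n)) : \bar R :=
  \big[mine/+oo%E]_(i < N)
    pos_or_infty (frob (row i Y - row i X *m W) ^+ 2
      - frob (row i Y) ^+ 2 * ((X *m mp_inv X) i i != 1)%:R).

(* The admissible values of c(W): the minimum when some term is positive, and
   an arbitrary positive number otherwise. *)
Definition is_c (R : realType) (N m n : nat) (X : 'M[R]_(N, m))
    (Y : 'M[R]_(N, n)) (W : 'M[R]_(m, n)) (c : R) : Prop :=
  0 < c /\ (cmin X Y W != +oo%E -> c%:E = cmin X Y W).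

(* Main.v *)
Require Import Defs.
From HB Require Import structures.
From mathcomp Require Import all_boot all_order all_algebra.
From mathcomp Require Import ring lra.
From mathcomp Require Import all_classical all_reals all_analysis.

Set Implicit Arguments.
Unset Strict Implicit.
Unset Printing Implicit Defensive.

Import Order.TTheory GRing.Theory Num.Theory.
Import numFieldNormedType.Exports.

Local Open Scope classical_set_scope.
Local Open Scope ring_scope.

(** Why the statement holds.  Let P = Xtrn Xtrn^+ be the orthogonal projection
    onto the column space of Xtrn.  A diagonal projection has entries 0 and 1
    only, and P Xtrn = Xtrn, so every sample i is of one of two kinds: if
    P_ii = 0, its input x_i vanishes and no W changes its residual y_i; if
    P_ii = 1, it is interpolated by W = Xtrn^+ Ytrn, whatever the weights are.
    The samples can thus be fitted independently of each other, and the value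
    function of the lower level is explicit ([lw_starE]); subtracting it gives
    [lw_gapE]:

      lw u W - lw_star u = 1/2 sum_i psi(u_i) gap_i(W),

    where gap_i(W) >= 0 is exactly the i-th term of the minimum c(W).

    In the variable u, the penalised loss is therefore a constant plus a
    nonnegative combination of the functions psi(u_i).  Its gradient acts
    coordinatewise through psi' = psi (1 - psi), which is 1-Lipschitz; this
    yields smoothness with the largest coefficient, itself at most
    gamma * lsq.  For the PL inequality, the constant bounds the infimum from
    below, and it remains to compare coordinate by coordinate, using that
    psi (1 - psi)^2 is smallest on [-ubar, ubar] at ubar
    ([sigmoid_box_weight]).

    In the variable W, the penalised loss is, up to a constant, the least
    squares loss of A = S M, where M stacks Xval over Xtrn and S is the
    invertible diagonal scaling by 1 and sqrt (gamma psi(u_i)).  A least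
    squares loss is |A|^2-smooth, and mu-PL as soon as A has an inner inverse
    G (that is, A G A = A) with mu |G|^2 <= 1 ([lsq_PL]).  The choice
    G = M^+ S^-1 separates the fixed matrix M from the weights, which are
    bounded below by psi(-ubar) on the box: this makes mu uniform in u. *)

(** * The Frobenius inner product *)

Definition frob_ip (R : realType) (p q : nat) (A B : 'M[R]_(p, q)) : R :=
  \tr (A^T *m B).

Section frobenius.
Context {R : realType}.
Implicit Types p q r : nat.

Lemma frob_ge0 p q (A : 'M[R]_(p, q)) : 0 <= frob A.
Proof. exact: sqrtr_ge0. Qed.

Lemma frob_sqE p q (A : 'M[R]_(p, q)) : frob A ^+ 2 = \sum_i \sum_j A i j ^+ 2.
Proof.
rewrite sqr_sqrtr// sumr_ge0// => i _.
by rewrite sumr_ge0// => j _; exact: sqr_ge0.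
Qed.

Lemma frob_sq_rows p q (A : 'M[R]_(p, q)) :
  frob A ^+ 2 = \sum_i frob (row i A) ^+ 2.
Proof.
rewrite frob_sqE; apply: eq_bigr => i _.
by rewrite frob_sqE big_ord1; apply: eq_bigr => j _; rewrite mxE.
Qed.

Lemma frob_sqZ p q a (A : 'M[R]_(p, q)) : frob (a *: A) ^+ 2 = a ^+ 2 * frob A ^+ 2.
Proof.
rewrite !frob_sqE mulr_sumr; apply: eq_bigr => i _.
by rewrite mulr_sumr; apply: eq_bigr => j _; rewrite mxE exprMn.
Qed.

Lemma frob_tr p q (A : 'M[R]_(p, q)) : frob A^T = frob A.
Proof.
rewrite /frob exchange_big; congr Num.sqrt.
by apply: eq_bigr => i _; apply: eq_bigr => j _; rewrite mxE.
Qed.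

Lemma frob_row_mx p q r (A : 'M[R]_(p, q)) (B : 'M[R]_(p, r)) :
  frob (row_mx A B) ^+ 2 = frob A ^+ 2 + frob B ^+ 2.
Proof.
rewrite !frob_sqE -big_split; apply: eq_bigr => i _ /=.
by rewrite big_split_ord; congr (_ + _); apply: eq_bigr => j _;
  rewrite ?row_mxEl ?row_mxEr.
Qed.

Lemma frob_col_mx p q r (A : 'M[R]_(p, q)) (B : 'M[R]_(r, q)) :
  frob (col_mx A B) ^+ 2 = frob A ^+ 2 + frob B ^+ 2.
Proof. by rewrite -frob_tr tr_col_mx frob_row_mx !frob_tr. Qed.

Lemma frob0 p q : frob (0 : 'M[R]_(p, q)) = 0.
Proof.
rewrite /frob big1 ?sqrtr0// => i _; rewrite big1// => j _.
by rewrite mxE expr0n.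
Qed.

Lemma frob1 p : frob (1%:M : 'M[R]_p) ^+ 2 = p%:R.
Proof. by rewrite frob_sq trmx1 mulmx1 mxtrace1. Qed.

Lemma frob_diag p (d : 'rV[R]_p) : frob (diag_mx d) ^+ 2 = \sum_i d 0 i ^+ 2.
Proof.
rewrite frob_sqE; apply: eq_bigr => i _.
rewrite (bigD1 i)//= mxE eqxx mulr1n big1 ?addr0// => j /negPf ji.
by rewrite mxE eq_sym ji mulr0n expr0n.
Qed.

Lemma frob_ipC p q (A B : 'M[R]_(p, q)) : frob_ip A B = frob_ip B A.
Proof. by rewrite /frob_ip -mxtrace_tr trmx_mul trmxK. Qed.

Lemma frob_sqD p q (A B : 'M[R]_(p, q)) :
  frob (A + B) ^+ 2 = frob A ^+ 2 + 2 * frob_ip A B + frob B ^+ 2.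
Proof.
have DT : (A + B)^T = A^T + B^T by rewrite linearD.
rewrite !frob_sq DT mulmxDl !mulmxDr !mxtraceD -!/(frob_ip _ _) (frob_ipC B); ring.
Qed.

Lemma frob_ipZr p q a (A B : 'M[R]_(p, q)) : frob_ip A (a *: B) = a * frob_ip A B.
Proof. by rewrite /frob_ip -scalemxAr mxtraceZ. Qed.

Lemma frob_ip_adj p q r (A : 'M[R]_(p, q)) (B : 'M[R]_(p, r)) (C : 'M[R]_(q, r)) :
  frob_ip B (A *m C) = frob_ip (A^T *m B) C.
Proof. by rewrite /frob_ip trmx_mul trmxK mulmxA. Qed.

Lemma frob_ip_delta p q (A : 'M[R]_(p, q)) i j : frob_ip A (delta_mx i j) = A i j.
Proof.
rewrite /frob_ip /mxtrace (bigD1 j)//= big1 ?addr0.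
  rewrite mxE (bigD1 i)//= !mxE !eqxx mulr1 big1 ?addr0// => k /negPf ki.
  by rewrite !mxE ki mulr0.
move=> k /negPf kj; rewrite mxE big1// => l _.
by rewrite !mxE kj andbF mulr0.
Qed.

(** Expands the square of |B|^2 A - <A, B> B, which is |B|^2 times the
    component of A orthogonal to B. *)
Lemma frob_cauchy_schwarz p q (A B : 'M[R]_(p, q)) :
  `|frob_ip A B| <= frob A * frob B.
Proof.
suff H : frob_ip A B ^+ 2 <= frob A ^+ 2 * frob B ^+ 2.
  rewrite -(@ler_pXn2r _ 2)// ?nnegrE ?mulr_ge0 ?frob_ge0//.
  by rewrite exprMn real_normK ?num_real.
have [B0|B0] := eqVneq (frob B ^+ 2) 0.
  by rewrite (frob_sq_eq0 B0) /frob_ip mulmx0 mxtrace0 frob0 expr0n mulr0.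
have := sqr_ge0 (frob (frob B ^+ 2 *: A + - frob_ip A B *: B)).
rewrite frob_sqD !frob_sqZ frob_ipZr (frob_ipC (_ *: A)) frob_ipZr (frob_ipC B).
have : 0 < frob B ^+ 2 by rewrite lt0r B0 sqr_ge0.
set a := frob A ^+ 2; set b := frob B ^+ 2; set c := frob_ip A B => b0 H.
rewrite -(ler_pM2l b0) -subr_ge0; apply: le_trans H _.
by rewrite le_eqVlt; apply/orP; left; apply/eqP; ring.
Qed.

Lemma frob_mulmx_sq p q r (A : 'M[R]_(p, q)) (B : 'M[R]_(q, r)) :
  frob (A *m B) ^+ 2 <= frob A ^+ 2 * frob B ^+ 2.
Proof.
rewrite (frob_sq_rows A) -(frob_tr B) (frob_sq_rows B^T) mulr_suml frob_sqE.
apply: ler_sum => i _; rewrite mulr_sumr; apply: ler_sum => j _.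
have -> : (A *m B) i j = frob_ip (row i A) (row j B^T).
  rewrite /frob_ip mxtrace_mulC /mxtrace big_ord1 !mxE; apply: eq_bigr => k _.
  by rewrite !mxE mulrC.
rewrite -exprMn -[leLHS]real_normK ?num_real// ler_pXn2r//
  ?nnegrE ?mulr_ge0 ?frob_ge0//.
exact: frob_cauchy_schwarz.
Qed.

Lemma frob_mulmx p q r (A : 'M[R]_(p, q)) (B : 'M[R]_(q, r)) :
  frob (A *m B) <= frob A * frob B.
Proof.
rewrite -(@ler_pXn2r _ 2)// ?nnegrE ?mulr_ge0 ?frob_ge0//.
by rewrite exprMn frob_mulmx_sq.
Qed.

End frobenius.

(** * Gradients and the PL inequality *)

(** Reduces partial derivatives to one-variable calculus, for which closed
    derivation rules apply. *)
Lemma derive_line (R : realType) (p q : nat) (f : 'M[R]_(p, q) -> R) x v :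
  'D_v f x = 'D_1 (fun h : R => f (h *: v + x)) 0.
Proof.
rewrite /derive; congr (lim (_ @ 0^')); apply/funext => h /=.
by rewrite scale0r add0r addr0 [h *: 1]mulr1.
Qed.

(** f x - inf f is the supremum of the differences f x - f y. *)
Lemma PL_on_pairwise (R : realType) (p q : nat) (A : set 'M[R]_(p, q))
    (f : 'M[R]_(p, q) -> R) (mu : R) :
  0 < mu -> (forall x, differentiable f x) -> has_lbound (range f) ->
  (forall x y, A x -> 2 * mu * (f x - f y) <= frob (grad f x) ^+ 2) ->
  PL_on A f mu.
Proof.
move=> mu0 fd fb H; split=> // x Ax.
rewrite -ler_pdivlMl ?mulr_gt0// lerBlDr -lerBlDl.
apply: lb_le_inf; first by exists (f x); exists x.
move=> _ [y _ <-]; rewrite lerBlDl -lerBlDr ler_pdivlMl ?mulr_gt0//.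
exact: H.
Qed.

(** * Least squares losses *)

Section least_squares.
Context {R : realType} {p m n : nat}.
Variables (A : 'M[R]_(p, m)) (B : 'M[R]_(p, n)) (k : R).

Let f W : R := lsq A B W + k.

Lemma lsq_expand V W :
  lsq A B (V + W) = lsq A B W + frob_ip (A^T *m (A *m W - B)) V
    + 2^-1 * frob (A *m V) ^+ 2.
Proof.
rewrite /lsq (mulmxDr A V W) -frob_ip_adj.
have -> : B - (A *m V + A *m W) = -1 *: ((A *m W - B) + A *m V).
  by move: (A *m V) (A *m W) => a b; apply/matrixP => i j; rewrite !mxE; ring.
have -> : B - A *m W = -1 *: (A *m W - B) by rewrite scaleN1r opprB.
rewrite !frob_sqZ sqrrN expr1n !mul1r frob_sqD; lra.
Qed.

Lemma differentiable_lsq W : differentiable f W.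
Proof.
have -> : f = (\sum_i \sum_j (2^-1 *: (fun W => (B - A *m W) i j) ^+ 2)) + cst k.
  apply/funext => V; rewrite /f /lsq frob_sqE mulr_sumr.
  rewrite -[RHS]/(_ V + _ V); congr (_ + _).
  rewrite fct_sumE; apply: eq_bigr => i _.
  rewrite fct_sumE mulr_sumr; apply: eq_bigr => j _.
  by rewrite exprfctE.
apply: differentiableD => //; apply: differentiable_sum => i.
apply: differentiable_sum => j; apply: differentiableZ; apply: differentiableX.
have -> : (fun W => (B - A *m W) i j)
    = cst (B i j) - \sum_l (A i l *: (fun W : 'M[R]_(m, n) => W l j)).
  apply/funext => V; rewrite !mxE -[RHS]/(_ - _ V); congr (_ - _).
  by rewrite fct_sumE.
apply: differentiableB => //; apply: differentiable_sum => l.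
by apply: differentiableZ; exact: differentiable_coord.
Qed.

Lemma grad_lsq W : grad f W = A^T *m (A *m W - B).
Proof.
apply/matrixP => i j; rewrite mxE derive_line -frob_ip_delta.
set g := frob_ip _ _.
have -> : (fun h : R => f (h *: delta_mx i j + W)) =
    (fun h : R => lsq A B W + k + h * g
       + h ^+ 2 * (2^-1 * frob (A *m delta_mx i j) ^+ 2)).
  apply/funext => h; rewrite /f lsq_expand frob_ipZr -scalemxAr frob_sqZ -/g; ring.
rewrite derive_val /=.
rewrite /GRing.scale/=; ring.
Qed.

Lemma lsq_smooth (L : R) : frob A ^+ 2 <= L -> smooth f L.
Proof.
move=> AL; split; first exact: differentiable_lsq.
move=> V W; rewrite !grad_lsq -mulmxBr opprB addrA subrK -mulmxBr.
apply: (le_trans (frob_mulmx _ _)).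
rewrite frob_tr (le_trans (ler_wpM2l (frob_ge0 _) (frob_mulmx _ _)))//.
by rewrite mulrA -expr2 ler_wpM2r ?frob_ge0.
Qed.

(** With r = A W - B, g = A^T r and D = V - W, the decrease from W to V is
    - <g, D> - |A D|^2 / 2.  Since A = A G A, replacing D by G A D changes
    neither term, so the decrease is at most |g| |G| |A D| - |A D|^2 / 2, whose
    maximum over the value of |A D| is |g|^2 |G|^2 / 2. *)
Lemma lsq_PL (G : 'M[R]_(m, p)) (mu : R) :
  A *m G *m A = A -> 0 < mu -> mu * frob G ^+ 2 <= 1 -> PL_on setT f mu.
Proof.
move=> AGA mu0 muG; apply: PL_on_pairwise => //.
- exact: differentiable_lsq.
- by exists k => _ [W _ <-]; rewrite lerDr mulr_ge0 ?invr_ge0 ?sqr_ge0.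
move=> W V _; rewrite grad_lsq.
have -> : V = (V - W) + W by rewrite subrK.
rewrite /f lsq_expand.
set D := V - W; set g := A^T *m _.
have -> : frob_ip g D = frob_ip g (G *m (A *m D)).
  by rewrite /g -!frob_ip_adj !mulmxA AGA.
(* It remains to bound a linear term in a = |A D| minus a square of a. *)
have := frob_cauchy_schwarz g (G *m (A *m D)).
have := ler_wpM2l (frob_ge0 g) (frob_mulmx G (A *m D)).
set a := frob (A *m D); set t := frob g; set c := frob_ip _ _ => h1.
rewrite ler_norml => /andP[h2 _].
have h3 : - c <= t * (frob G * a) by rewrite lerNl (le_trans _ h2)// lerN2.
have h4 : 2 * (t * (frob G * a)) <= t ^+ 2 * frob G ^+ 2 + a ^+ 2.
  by rewrite -subr_ge0; have := sqr_ge0 (t * frob G - a); congr (_ <= _); ring.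
have h5 : t ^+ 2 * (mu * frob G ^+ 2) <= t ^+ 2 * 1 by rewrite ler_wpM2l ?sqr_ge0.
rewrite mulr1 in h5; apply: le_trans h5.
rewrite [leRHS]mulrCA (mulrC 2) -mulrA ler_pM2l//; lra.
Qed.

End least_squares.

(** * The sigmoid *)

Section sigmoid.
Context {R : realType}.
Implicit Types s t : R.

Lemma sigmoid_gt0 t : 0 < sigmoid t.
Proof. by rewrite invr_gt0 ltr_wpDr ?expR_ge0. Qed.

Lemma sigmoid_lt1 t : sigmoid t < 1.
Proof. by rewrite invf_lt1 ?ltrDl ?expR_gt0// ltr_wpDr ?expR_ge0. Qed.

Lemma sigmoidN t : sigmoid (- t) = 1 - sigmoid t.
Proof.
have e0 := expR_gt0 t; rewrite /sigmoid opprK expRN.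
by field; rewrite !lt0r_neq0 ?addr_gt0.
Qed.

Lemma sigmoid_homo s t : s <= t -> sigmoid s <= sigmoid t.
Proof.
move=> st; rewrite lef_pV2 ?posrE ?ltr_wpDr ?expR_ge0//.
by rewrite lerD2l ler_expR lerN2.
Qed.

Lemma is_derive_sigmoid t : is_derive t 1 (@sigmoid R) (sigmoid t * (1 - sigmoid t)).
Proof.
have d0 : 1 + expR (- t) != 0 by rewrite lt0r_neq0// ltr_wpDr ?expR_ge0.
have dexp : is_derive t 1 (fun x : R => 1 + expR (- x)) (- expR (- t)).
  have d1 : is_derive t 1 (fun x => expR (- x)) (expR (- t) * (- 1)).
    exact: is_derive1_comp.
  by have := is_deriveD (is_derive_cst (1 : R) t 1) d1; rewrite add0r mulrN1.
apply: (@is_derive_eq _ _ _ (fun x : R => (1 + expR (- x))^-1)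
  _ _ _ _ (is_deriveV (f := fun x => 1 + expR (- x)) d0 dexp)).
by rewrite /sigmoid /GRing.scale/=; field.
Qed.

Lemma sigmoid_lip s t : `|sigmoid s - sigmoid t| <= `|s - t|.
Proof.
wlog ts : s t / t <= s.
  move=> H; have [/H//|/ltW/H] := leP t s.
  by rewrite distrC (distrC s).
have [|||c _ ->] := @MVT_segment R (@sigmoid R)
  (fun x => sigmoid x * (1 - sigmoid x)) t s.
- by [].
- by move=> x _; exact: is_derive_sigmoid.
- apply: continuous_subspaceT => x; apply/differentiable_continuous.
  by apply/derivable1_diffP; have := is_derive_sigmoid x => /@ex_derive.
have c0 := sigmoid_gt0 c; have c1 := sigmoid_lt1 c.
rewrite normrM ler_piMl// ger0_norm; last by rewrite mulr_ge0 ?subr_ge0 ?ltW.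
by apply: mulr_ile1; lra.
Qed.

(** The difference of s (1 - s) and t (1 - t) is (s - t) (1 - s - t), and the
    last factor lies in [-1, 1] for values in [0, 1]. *)
Lemma sigmoid_deriv_lip s t :
  `|sigmoid s * (1 - sigmoid s) - sigmoid t * (1 - sigmoid t)| <= `|s - t|.
Proof.
apply: le_trans (sigmoid_lip s t).
have -> : sigmoid s * (1 - sigmoid s) - sigmoid t * (1 - sigmoid t) =
    (sigmoid s - sigmoid t) * (1 - sigmoid s - sigmoid t) by ring.
rewrite normrM ler_piMr// ler_norml.
have := sigmoid_gt0 s; have := sigmoid_lt1 s.
have := sigmoid_gt0 t; have := sigmoid_lt1 t; lra.
Qed.

(** The sigmoid takes its values in [1 - p, p] on the box, with p = psi(ub).
    There x (1 - x)^2 increases up to 1/3 and decreases afterwards, so its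
    minimum is at an endpoint, and p (1 - p)^2 <= (1 - p) p^2 since
    1 - p <= p. *)
Lemma sigmoid_box_weight (ub t : R) : - ub <= t <= ub ->
  sigmoid ub * (1 - sigmoid ub) ^+ 2 <= sigmoid t * (1 - sigmoid t) ^+ 2.
Proof.
move=> /andP[/sigmoid_homo + /sigmoid_homo]; rewrite sigmoidN.
have := sigmoid_lt1 ub; have := sigmoid_gt0 ub.
move: (sigmoid ub) (sigmoid t) => p s p0 p1 ps sp.
(* Factors s (1 - s)^2 - p (1 - p)^2 through p - s, and writes the quadratic
   cofactor as its chord over [1 - p, p] plus a product of nonnegative terms. *)
have -> : s * (1 - s) ^+ 2 = p * (1 - p) ^+ 2
    + (p - s) * ((s - (1 - p)) * (p - s) + (1 - p) * (s + 2 * p - 1)) by ring.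
rewrite lerDl; apply: mulr_ge0; first lra.
by apply: addr_ge0; apply: mulr_ge0; lra.
Qed.

End sigmoid.

(** * Nonnegative combinations of sigmoids *)

Section separable.
Context {R : realType} {N : nat}.
Variables (a : 'I_N -> R) (k : R).
Hypothesis a_ge0 : forall i, 0 <= a i.

Let f (u : 'rV[R]_N) : R := k + \sum_i a i * sigmoid (u 0 i).

Lemma differentiable_sum_sigmoid u : differentiable f u.
Proof.
have -> : f = cst k + \sum_i (a i *: (@sigmoid R \o (fun v : 'rV[R]_N => v 0 i))).
  by apply/funext => v; rewrite -[RHS]/(k + _ v); congr (_ + _); rewrite fct_sumE.
apply: differentiableD => //; apply: differentiable_sum => i.
apply: differentiableZ; apply: differentiable_comp.
  exact: differentiable_coord.
by apply/derivable1_diffP; have := is_derive_sigmoid (u 0 i) => /@ex_derive.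
Qed.

Lemma grad_sum_sigmoid u i j :
  grad f u i j = a j * (sigmoid (u 0 j) * (1 - sigmoid (u 0 j))).
Proof.
rewrite mxE (ord1 i).
have H : 'D_1 (a j *: @sigmoid R) (u 0 j)
    = a j * (sigmoid (u 0 j) * (1 - sigmoid (u 0 j))).
  have := is_deriveZ (a j) (is_derive_sigmoid (u 0 j)).
  by move=> dZ; rewrite derive_val.
rewrite -{}H /derive; congr (lim (_ @ 0^')); apply/funext => h /=.
rewrite /f [h *: 1]mulr1; congr (_ *: _).
rewrite (bigD1 j)// [in X in _ - X](bigD1 j)//= !mxE !eqxx mulr1.
rewrite (eq_bigr (fun i => a i * sigmoid (u 0 i))); last first.
  by move=> l /negPf lj; rewrite !mxE lj mulr0 add0r.
rewrite -[(a j *: _) _]/(a j * _) -[(a j *: _) (u 0 j)]/(a j * _); ring.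
Qed.

Lemma sum_sigmoid_smooth (L : R) : 0 <= L -> (forall i, a i <= L) -> smooth f L.
Proof.
move=> L0 aL; split; first exact: differentiable_sum_sigmoid.
move=> u v; rewrite -(@ler_pXn2r _ 2)// ?nnegrE ?mulr_ge0 ?frob_ge0//.
rewrite exprMn !frob_sqE mulr_sumr; apply: ler_sum => i _.
rewrite mulr_sumr; apply: ler_sum => j _.
rewrite mxE [X in (_ + X) ^+ 2]mxE !grad_sum_sigmoid -mulrBr !exprMn.
apply: ler_pM; rewrite ?sqr_ge0//.
  by rewrite ler_pXn2r ?nnegrE.
rewrite -[leLHS]real_normK ?num_real// -[leRHS]real_normK ?num_real//.
rewrite ler_pXn2r ?nnegrE// (ord1 i) !mxE.
exact: sigmoid_deriv_lip.
Qed.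

(** With k as a lower bound of f, the inequality splits into coordinates.  In
    each, the common factor a_i psi(u_i) leaves the product of the bounds
    c <= a_i and [sigmoid_box_weight]; coordinates with a_i = 0 contribute
    nothing to either side. *)
Lemma sum_sigmoid_PL (ub c : R) : 0 < c -> (forall i, 0 < a i -> c <= a i) ->
  PL_on (box ub) f (c * (sigmoid ub * (1 - sigmoid ub) ^+ 2) / 2).
Proof.
move=> c0 ac.
have fk v : k <= f v.
  by rewrite lerDl sumr_ge0// => i _; rewrite mulr_ge0// ltW// sigmoid_gt0.
apply: PL_on_pairwise; first last.
- move=> u v ubox.
  set w := sigmoid ub * _.
  have w0 : 0 < w by rewrite mulr_gt0 ?exprn_gt0 ?subr_gt0 ?sigmoid_gt0 ?sigmoid_lt1.
  apply: (@le_trans _ _ (c * w * (f u - k))).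
    have -> : 2 * (c * w / 2) = c * w by field.
    by apply: ler_wpM2l; [rewrite mulr_ge0 ?ltW | rewrite lerD2l lerN2].
  rewrite frob_sqE big_ord1 /f addrC addKr mulr_sumr; apply: ler_sum => i _.
  rewrite grad_sum_sigmoid.
  have [ai0|ai0] := ltP 0 (a i); last first.
    have -> : a i = 0 by apply/eqP; rewrite eq_le ai0 a_ge0.
    by rewrite !mul0r mulr0 expr0n.
  have s0 := sigmoid_gt0 (u 0 i).
  rewrite [leLHS](_ : _ = (a i * sigmoid (u 0 i)) * (c * w)); last by ring.
  rewrite [leRHS](_ : _ = (a i * sigmoid (u 0 i)) *
    (a i * (sigmoid (u 0 i) * (1 - sigmoid (u 0 i)) ^+ 2))); last by ring.
  rewrite ler_wpM2l ?mulr_ge0 ?(ltW s0)//.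
  apply: ler_pM; rewrite ?(ltW c0) ?(ltW w0) ?ac//.
  exact: sigmoid_box_weight (ubox i).
- by exists k => _ [v _ <-].
- exact: differentiable_sum_sigmoid.
- by rewrite divr_gt0 ?mulr_gt0 ?exprn_gt0 ?subr_gt0 ?sigmoid_gt0 ?sigmoid_lt1.
Qed.

End separable.

(** * The reweighted training loss *)

Section reweighted_loss.
Context {R : realType} {N m n : nat}.
Variables (X : 'M[R]_(N, m)) (Y : 'M[R]_(N, n)).
Implicit Types (u : 'rV[R]_N) (W : 'M[R]_(m, n)).

Lemma row_diag_mulmx p (d : 'rV[R]_N) (Z : 'M[R]_(N, p)) i :
  row i (diag_mx d *m Z) = d 0 i *: row i Z.
Proof. by rewrite row_mul row_diag_mx -scalemxAl -rowE. Qed.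

Lemma sqrt_psi_mxE u :
  sqrt_psi_mx u = diag_mx (map_mx (fun t => Num.sqrt (sigmoid t)) u).
Proof.
apply/matrixP => i j; rewrite !mxE.
by case: (i == j); rewrite ?mulr1n// !mulr0n sqrtr0.
Qed.

Lemma frob_sq_sqrt_psi p u (Z : 'M[R]_(N, p)) :
  frob (sqrt_psi_mx u *m Z) ^+ 2 = \sum_i sigmoid (u 0 i) * frob (row i Z) ^+ 2.
Proof.
rewrite frob_sq_rows sqrt_psi_mxE; apply: eq_bigr => i _.
by rewrite row_diag_mulmx mxE frob_sqZ sqr_sqrtr ?ltW ?sigmoid_gt0.
Qed.

Lemma frob_sq_sqrt_psi_le p u (Z : 'M[R]_(N, p)) :
  frob (sqrt_psi_mx u *m Z) ^+ 2 <= frob Z ^+ 2.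
Proof.
rewrite frob_sq_sqrt_psi frob_sq_rows; apply: ler_sum => i _.
by rewrite ler_piMl ?sqr_ge0// ltW ?sigmoid_lt1.
Qed.

Lemma lwE u W : lw X Y u W =
  \sum_i sigmoid (u 0 i) * (2^-1 * frob (row i Y - row i X *m W) ^+ 2).
Proof.
rewrite /lw frob_sq_sqrt_psi mulr_sumr; apply: eq_bigr => i _.
by rewrite linearB /= row_mul mulrCA.
Qed.

(** The squared residual of W on sample i in excess of the smallest one
    attainable on that sample, when [X *m mp_inv X] is diagonal; also the term
    that [cmin] minimises. *)
Definition gap W i : R :=
  frob (row i Y - row i X *m W) ^+ 2
    - frob (row i Y) ^+ 2 * ((X *m mp_inv X) i i != 1)%:R.

Lemma gap_le W i : gap W i <= frob (row i Y - row i X *m W) ^+ 2.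
Proof. by rewrite gerBl mulr_ge0 ?sqr_ge0. Qed.

Lemma gap_le_lsq W i : gap W i <= 2 * lsq X Y W.
Proof.
apply: (le_trans (gap_le W i)).
rewrite /lsq mulrA divff ?pnatr_eq0// mul1r [leRHS]frob_sq_rows.
rewrite (bigD1 i)//= linearB /= row_mul lerDl.
by rewrite sumr_ge0// => j _; exact: sqr_ge0.
Qed.

Lemma is_c_le_gap W c i : is_c X Y W c -> 0 < gap W i -> c <= gap W i.
Proof.
move=> [_ cE] gap0.
have H : (cmin X Y W <= (gap W i)%:E)%E.
  by rewrite /cmin (bigD1 i)//= -/(gap W i) /pos_or_infty gap0 ge_min lexx.
rewrite -lee_fin cE//; apply/eqP => cmin_oo.
by move: H; rewrite cmin_oo leNgt ltry.
Qed.

Hypothesis diagP : is_diag_mx (X *m mp_inv X).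
Let P := X *m mp_inv X.

Lemma mul_proj p (Z : 'M[R]_(N, p)) i : row i (P *m Z) = P i i *: row i Z.
Proof.
have /diag_mxP[d PE] := diagP.
by rewrite /P PE row_diag_mulmx !mxE eqxx mulr1n.
Qed.

Lemma proj_row i : row i X = P i i *: row i X.
Proof. by rewrite -mul_proj; have [-> _ _ _] := mp_invP X. Qed.

(** The diagonal entries of a diagonal idempotent matrix are idempotent
    scalars. *)
Lemma proj01 i : P i i != 1 -> P i i = 0.
Proof.
have := mul_proj P i.
have -> : P *m P = P by rewrite /P mulmxA; have [-> _ _ _] := mp_invP X.
move=> /matrixP/(_ 0 i); rewrite mxE [RHS]mxE [X in _ = _ * X]mxE => PP P1.
have /eqP : P i i * (P i i - 1) = 0 by rewrite mulrBr -PP mulr1 subrr.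
by rewrite mulf_eq0 subr_eq0 (negPf P1) orbF => /eqP.
Qed.

Lemma proj_neq1_row0 i : P i i != 1 -> row i X = 0.
Proof. by move=> /proj01 P0; rewrite proj_row P0 scale0r. Qed.

Lemma gap_ge0 W i : 0 <= gap W i.
Proof.
rewrite /gap; case: eqVneq => [_|/proj_neq1_row0 ->].
  by rewrite mulr0 subr0 sqr_ge0.
by rewrite mul0mx subr0 mulr1 subrr.
Qed.

(** The interpolant [mp_inv X *m Y] is optimal on every sample separately: it
    fits those with P_ii = 1 exactly, and on the others x_i = 0, so that every
    W has the same residual y_i. *)
Lemma lw_starE u : lw_star X Y u =
  \sum_i sigmoid (u 0 i) * (2^-1 * (frob (row i Y) ^+ 2 * (P i i != 1)%:R)).
Proof.
have [W0 -> W0min] := lw_star_min X Y u.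
apply/eqP; rewrite eq_le; apply/andP; split.
  apply: (le_trans (W0min (mp_inv X *m Y))).
  rewrite lwE le_eqVlt; apply/orP; left; apply/eqP; apply: eq_bigr => i _.
  rewrite mulmxA -row_mul -/P; congr (_ * (_ * _)).
  rewrite -row_mul mul_proj; case: eqVneq => [->|/proj01 ->].
    by rewrite scale1r subrr frob0 expr0n mulr0.
  by rewrite scale0r subr0 mulr1.
rewrite lwE; apply: ler_sum => i _.
rewrite ler_wpM2l ?(ltW (sigmoid_gt0 _))// ler_pM2l ?invr_gt0//.
by have := gap_ge0 W0 i; rewrite subr_ge0.
Qed.

Lemma lw_gapE u W :
  lw X Y u W - lw_star X Y u = \sum_i 2^-1 * gap W i * sigmoid (u 0 i).
Proof.
rewrite lwE lw_starE -sumrB; apply: eq_bigr => i _.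
by rewrite -mulrBr -mulrBr mulrC.
Qed.

End reweighted_loss.

(** * The penalised loss as a stacked least squares loss *)

Section stacked_least_squares.
Context {R : realType} {N N' m n : nat}.
Variables (Xtrn : 'M[R]_(N, m)) (Ytrn : 'M[R]_(N, n)).
Variables (Xval : 'M[R]_(N', m)) (Yval : 'M[R]_(N', n)).
Variables (gamma : R) (u : 'rV[R]_N).
Hypothesis gamma_gt0 : 0 < gamma.

Let S : 'M[R]_N := Num.sqrt gamma *: sqrt_psi_mx u.
Let T : 'M[R]_N := diag_mx (map_mx (fun t => (Num.sqrt (gamma * sigmoid t))^-1) u).

Lemma scaling_mulV : T *m S = 1%:M.
Proof.
have S_E : S = diag_mx (map_mx (fun t => Num.sqrt (gamma * sigmoid t)) u).
  rewrite /S sqrt_psi_mxE; apply/matrixP => i j; rewrite !mxE.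
  by case: (i == j); rewrite ?mulr0n ?mulr0// !mulr1n sqrtrM// ltW.
rewrite S_E mulmx_diag; apply/matrixP => i j; rewrite !mxE.
by rewrite mulVf// lt0r_neq0// sqrtr_gt0 mulr_gt0 ?sigmoid_gt0.
Qed.

Lemma frob_sq_scaling_inv ub : box ub u ->
  frob T ^+ 2 <= N%:R / (gamma * sigmoid (- ub)).
Proof.
move=> ubox; rewrite frob_diag.
have -> : N%:R / (gamma * sigmoid (- ub)) = \sum_(i < N) (gamma * sigmoid (- ub))^-1.
  by rewrite sumr_const card_ord mulr_natl.
apply: ler_sum => i _; have /andP[ui _] := ubox i.
have pos t : 0 < gamma * sigmoid t by rewrite mulr_gt0 ?sigmoid_gt0.
rewrite mxE exprVn sqr_sqrtr ?(ltW (pos _))// lef_pV2 ?posrE//.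
by rewrite ler_wpM2l ?(ltW gamma_gt0)// sigmoid_homo.
Qed.

Let A : 'M[R]_(N' + N, m) := col_mx Xval (S *m Xtrn).
Let B : 'M[R]_(N' + N, n) := col_mx Yval (S *m Ytrn).

Lemma lgamma_lsqE W : lgamma Xtrn Ytrn Xval Yval gamma u W =
  lsq A B W + - gamma * lw_star Xtrn Ytrn u.
Proof.
rewrite /lgamma /lsq /lw /A /B mul_col_mx opp_col_mx add_col_mx frob_col_mx.
rewrite -mulmxA -mulmxBr /S -scalemxAl frob_sqZ (sqr_sqrtr (ltW gamma_gt0)); ring.
Qed.

Lemma frob_sq_stacked :
  frob A ^+ 2 <= frob Xval ^+ 2 + gamma * frob Xtrn ^+ 2.
Proof.
rewrite /A frob_col_mx lerD2l /S -scalemxAl frob_sqZ (sqr_sqrtr (ltW gamma_gt0)).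
by rewrite ler_wpM2l ?(ltW gamma_gt0)// frob_sq_sqrt_psi_le.
Qed.

Let M := col_mx Xval Xtrn.
Let G := mp_inv M *m block_mx 1%:M 0 0 T.

(** As A = diag(1, S) M with an invertible left factor, the inverse
    scaling followed by an inner inverse of M is one of A.  Pseudoinverses, by
    contrast, do not compose in this way with invertible factors. *)
Lemma stacked_ginv : A *m G *m A = A.
Proof.
have AE : A = block_mx 1%:M 0 0 S *m M.
  by rewrite /A /M mul_block_col !mul1mx !mul0mx addr0 add0r.
have TA : block_mx 1%:M 0 0 T *m A = M.
  by rewrite /A /M mul_block_col !mul1mx !mul0mx addr0 add0r mulmxA
    scaling_mulV mul1mx.
have [MGM _ _ _] := mp_invP M.
by rewrite /G -!mulmxA TA {1}AE -mulmxA (mulmxA M) MGM -AE.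
Qed.

Lemma frob_sq_stacked_ginv ub : box ub u ->
  frob G ^+ 2 <= frob (mp_inv M) ^+ 2 * (N'%:R + N%:R / (gamma * sigmoid (- ub))).
Proof.
move=> ubox; apply: (le_trans (frob_mulmx_sq _ _)).
rewrite ler_wpM2l ?sqr_ge0// /block_mx frob_col_mx !frob_row_mx.
by rewrite frob1 !frob0 expr0n /= addr0 add0r lerD2l frob_sq_scaling_inv.
Qed.

End stacked_least_squares.

(** * Smoothness and PL constants *)

Lemma bigO_infty_bound (R : realType) (f g : R -> R) (k : R) : 0 < k ->
  (forall x, 1 <= x -> `|f x| <= k * `|g x|) -> bigO_infty f g.
Proof.
move=> k0 fg; apply: (@eqO_exP R R R R (pinfty_filter_on R) g f).2; exists k => //.
by near=> x; apply: fg; near: x; exact: nbhs_pinfty_ge.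
Unshelve. all: by end_near.
Qed.

Theorem lemma2 (R : realType) (N N' m n : nat)
    (Xtrn : 'M[R]_(N, m)) (Ytrn : 'M[R]_(N, n))
    (Xval : 'M[R]_(N', m)) (Yval : 'M[R]_(N', n))
    (ubar psit : R)
    (ubar_gt0 : 0 < ubar) (psit_gt0 : 0 < psit)
    (overparam : (maxn N N' <= m)%N)
    (rank_deficient : (\rank (col_mx Xval Xtrn) < N' + N)%N)
    (rank_reweighted : exists2 ustar : 'rV[R]_N, box ubar ustar &
       \rank (col_mx Xval (sqrt_psi_mx ustar *m Xtrn)) =
         (N + N' - #|[pred i : 'I_N | (sigmoid (ustar 0 i) < psit)%R]|)%N)
    (diag_proj : is_diag_mx (Xtrn *m mp_inv Xtrn)) :
  (exists L mu : R -> R,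
     [/\ bigO_infty L id,
         bigO_infty mu id &
         forall gamma, 0 < gamma ->
           [/\ 0 < L gamma, 0 < mu gamma &
               forall u, box ubar u ->
                 smooth (lgamma Xtrn Ytrn Xval Yval gamma u) (L gamma) /\
                 PL_on setT (lgamma Xtrn Ytrn Xval Yval gamma u) (mu gamma)]])
  /\
  (forall gamma (W : 'M[R]_(m, n)), 0 < gamma ->
     smooth (fun u => lgamma Xtrn Ytrn Xval Yval gamma u W)
       (gamma * lsq Xtrn Ytrn W) /\
     (forall c, is_c Xtrn Ytrn W c ->
        PL_on (box ubar) (fun u => lgamma Xtrn Ytrn Xval Yval gamma u W)
          (gamma * c * sigmoid ubar * (1 - sigmoid ubar) ^+ 2 / 4))).
Proof.
split.
  (* The summand 1 keeps a and K positive even if the matrices vanish. *)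
  pose a := 1 + frob Xval ^+ 2; pose b := frob Xtrn ^+ 2.
  pose q := frob (mp_inv (col_mx Xval Xtrn)) ^+ 2.
  pose K gamma : R := 1 + q * (N'%:R + N%:R / (gamma * sigmoid (- ubar))).
  have a0 : 0 < a by rewrite ltr_wpDr ?sqr_ge0.
  have b0 : 0 <= b := sqr_ge0 _.
  have K1 gamma : 0 < gamma -> 1 <= K gamma.
    move=> g0; rewrite lerDl mulr_ge0 ?sqr_ge0// addr_ge0// divr_ge0//.
    by rewrite mulr_ge0 ?ltW ?sigmoid_gt0.
  (* By K1, the PL constant 1 / K is at most 1, hence O(gamma). *)
  exists (fun gamma => a + gamma * b), (fun gamma => (K gamma)^-1); split.
  - apply: (@bigO_infty_bound R _ _ (a + b)) => [|gamma g1].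
      by rewrite ltr_wpDr.
    have g0 : 0 < gamma by rewrite (lt_le_trans ltr01).
    have L0 : 0 <= a + gamma * b := addr_ge0 (ltW a0) (mulr_ge0 (ltW g0) b0).
    rewrite !ger0_norm ?(ltW g0)//.
    by rewrite mulrDl (mulrC b) lerD2r ler_peMr// ltW.
  - apply: (@bigO_infty_bound R _ _ 1) => [//|gamma g1].
    have k1 := K1 _ (lt_le_trans ltr01 g1).
    have k0 : 0 < K gamma by rewrite (lt_le_trans ltr01).
    rewrite mul1r !ger0_norm ?invr_ge0 ?(ltW k0)//; last by apply: le_trans g1.
    by apply: le_trans g1; rewrite invf_le1.
  - move=> gamma g0.
    have k0 : 0 < K gamma by rewrite (lt_le_trans ltr01)// K1.
    split; [exact: ltr_wpDr (mulr_ge0 (ltW g0) b0) a0|by rewrite invr_gt0|].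
    move=> u ubox.
    rewrite (_ : lgamma Xtrn Ytrn Xval Yval gamma u = (fun W => lsq
      (col_mx Xval (Num.sqrt gamma *: sqrt_psi_mx u *m Xtrn))
      (col_mx Yval (Num.sqrt gamma *: sqrt_psi_mx u *m Ytrn)) W
      + - gamma * lw_star Xtrn Ytrn u)); last first.
      by apply/funext => W; exact: lgamma_lsqE.
    split.
      apply: lsq_smooth; apply: (le_trans (frob_sq_stacked _ _ _ g0)).
      by rewrite lerD2r lerDr.
    apply: (lsq_PL _ _ (stacked_ginv Xtrn Xval u g0)); rewrite ?invr_gt0//.
    rewrite ler_pdivrMl// mulr1.
    apply: (le_trans (frob_sq_stacked_ginv _ _ g0 ubox)).
    by rewrite lerDr.
move=> gamma W g0.
pose coef i := gamma / 2 * gap Xtrn Ytrn W i.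
have coef0 i : 0 <= coef i by rewrite mulr_ge0 ?gap_ge0// divr_ge0// ltW.
rewrite (_ : (fun u => _) = (fun u : 'rV_N =>
    lsq Xval Yval W + \sum_i coef i * sigmoid (u 0 i))); last first.
  apply/funext => u; rewrite /lgamma lw_gapE// mulr_sumr; congr (_ + _).
  by apply: eq_bigr => i _; rewrite /coef !mulrA.
split.
  apply: sum_sigmoid_smooth => //.
    by rewrite mulr_ge0 ?(ltW g0)// mulr_ge0 ?invr_ge0 ?sqr_ge0.
  move=> i; rewrite /coef -mulrA ler_wpM2l ?(ltW g0)//.
  by rewrite ler_pdivrMl// gap_le_lsq.
move=> c cW; have [c0 _] := cW.
rewrite (_ : gamma * c * sigmoid ubar * _ / 4 =
  gamma / 2 * c * (sigmoid ubar * (1 - sigmoid ubar) ^+ 2) / 2); last by field.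
have g2 : 0 < gamma / 2 by rewrite divr_gt0.
apply: sum_sigmoid_PL => //; first by rewrite mulr_gt0.
move=> i; rewrite /coef pmulr_rgt0// ler_pM2l//.
exact: is_c_le_gap.
Qed.
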